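(* Let $\mathcal{A}=(A,[\cdot,\cdot,\cdot],\alpha)$ be a $3$-Hom-Lie algebra of the class $4_{3,N(2),6}$ (defined in the context), with structure constants $c(1,2,4,p),\,c(1,3,4,p)\in\mathbb{K}$, $1\le p\le 4$, and bracket matrix $B$, and suppose $B\neq 0$. For $1\le p,q\le 4$ put $$d(p,q)=c(1,2,4,p)\,c(1,3,4,q)-c(1,2,4,q)\,c(1,3,4,p).$$ Then $\mathcal{A}$ is $3$-solvable of class $2$. $\mathcal{A}$ is $2$-solvable if and only if $d(1,4)=0$. Moreover, $d(1,4)=0$ implies that there exists $(\lambda,\lambda')\in\mathbb{K}^2\setminus\{(0,0)\}$ such that $\lambda d(2,4)+\lambda' d(1,2)=0$ and $\lambda d(3,4)+\lambda' d(1,3)=0$, or equivalently that the matrix $$M=\begin{pmatrix} d(2,4) & d(3,4)\\ d(1,2) & d(1,3)\end{pmatrix}$$ has rank less than $2$, which is equivalent to $\det M=0$. If $\operatorname{rank} B=2$, or equivalently if there exist $1\le p<q\le 4$ with $d(p,q)\neq 0$, then: 1) $Z(\mathcal{A})=\{0\}$, and $\mathcal{A}$ is not nilpotent. 2) If $\mathcal{A}$ is $2$-solvable, then: (a) if $M\neq 0$, $\mathcal{A}$ is $2$-solvable of class $3$; (b) if $M=0$, $\mathcal{A}$ is $2$-solvable of class $2$. If $\operatorname{rank} B=1$, or equivalently if $d(p,q)=0$ for all $1\le p<q\le 4$, then $\mathcal{A}$ is $2$-solvable of class $2$, $\dim Z(\mathcal{A})=1$, and $$Z(\mathcal{A})=\langle\{\,c(1,3,4,p)\,e_2-c(1,2,4,p)\,e_3\,\}\rangle,$$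 where $p\in\{1,2,3,4\}$ is an index such that $c(1,2,4,p)\neq 0$ or $c(1,3,4,p)\neq 0$. Moreover, in this case ($\operatorname{rank} B=1$), $\mathcal{A}$ is nilpotent if and only if $Z(\mathcal{A})=[A,A,A]$, or equivalently if and only if $$c(1,2,4,1)=c(1,2,4,4)=c(1,3,4,1)=c(1,3,4,4)=0,$$ $$c(1,3,4,p)\,c(1,2,4,3)+c(1,2,4,p)\,c(1,2,4,2)=0,$$ $$c(1,3,4,p)\,c(1,3,4,3)+c(1,2,4,p)\,c(1,3,4,2)=0$$ for such an index $p$.
   Context: $\mathbb{K}$ is a field of characteristic $0$, and $\langle S\rangle$ denotes the linear span of $S$. A $3$-Hom-Lie algebra $(A,[\cdot,\cdot,\cdot],\alpha)$ is a $\mathbb{K}$-linear space $A$ with a trilinear skew-symmetric bracket and a linear map $\alpha:A\to A$ (the twisting map) satisfying the Hom-Nambu-Filippov identity $$[\alpha(x_1),\alpha(x_2),[y_1,y_2,y_3]]=[[x_1,x_2,y_1],\alpha(y_2),\alpha(y_3)]+[\alpha(y_1),[x_1,x_2,y_2],\alpha(y_3)]+[\alpha(y_1),\alpha(y_2),[x_1,x_2,y_3]].$$ The class $4_{3,N(2),6}$ consists of the $4$-dimensional $3$-Hom-Lie algebras $(A,[\cdot,\cdot,\cdot],\alpha)$ with basis $e_1,e_2,e_3,e_4$, with $\alpha(e_1)=\alpha(e_2)=0$, $\alpha(e_3)=e_2$, $\alpha(e_4)=e_3$, and with skew-symmetric bracket determined by $$[e_1,e_2,e_3]=0,\quad [e_1,e_2,e_4]=\sum_{p=1}^4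 c(1,2,4,p)e_p,\quad [e_1,e_3,e_4]=\sum_{p=1}^4 c(1,3,4,p)e_p,\quad [e_2,e_3,e_4]=0,$$ where the eight structure constants $c(1,2,4,p),c(1,3,4,p)\in\mathbb{K}$ are arbitrary parameters. The bracket matrix $B$ is the $4\times4$ matrix whose first and fourth columns are zero, whose second column is $(c(1,3,4,p))_{1\le p\le 4}$ and whose third column is $(-c(1,2,4,p))_{1\le p\le4}$. $[A,A,A]$ denotes the linear span of all brackets. For $k\in\{2,3\}$ the $k$-derived series of $\mathcal{A}$ is $D_k^0(\mathcal A)=A$ and $D_k^{r+1}(\mathcal A)=\langle[D_k^r(\mathcal A),\dots,D_k^r(\mathcal A),A,\dots,A]\rangle$, with $k$ entries $D_k^r(\mathcal A)$ and $3-k$ entries $A$. $\mathcal{A}$ is $k$-solvable if $D_k^r(\mathcal A)=\{0\}$ for some $r\in\mathbb{N}$, and the smallest such $r$ is the class of $k$-solvability. The central descending series is $C^0(A)=A$, $C^{r+1}(A)=\langle[C^r(A),A,A]\rangle$; $\mathcal A$ is nilpotent if $C^r(A)=\{0\}$ for some $r\in\mathbb{N}$. The center is $Z(\mathcal A)=\{z\in A:[x,y,z]=0\ \forall x,y\in A\}$. *)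

(* Defs.v *)
From HB Require Import structures.
From mathcomp Require Import all_boot all_order all_fingroup all_algebra.
From mathcomp Require Import boolp classical_sets.

Set Implicit Arguments.
Unset Strict Implicit.
Unset Printing Implicit Defensive.

Import GRing.Theory.
Local Open Scope ring_scope.
Local Open Scope classical_set_scope.

(* One-based names for the four indices. *)
Definition i1 : 'I_4 := @Ordinal 4 0 isT.
Definition i2 : 'I_4 := @Ordinal 4 1 isT.
Definition i3 : 'I_4 := @Ordinal 4 2 isT.
Definition i4 : 'I_4 := @Ordinal 4 3 isT.

(* Multiplicativity of the twisting map is not required. *)
Record hom_lie3 (K : fieldType) (A : lmodType K) := HomLie3 {
  br : A -> A -> A -> A;
  twist : {linear A -> A};
  br_linear1 : forall y z, linear (fun x => br x y z);
  br_linear2 : forall x z, linear (fun y => br x y z);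
  br_linear3 : forall x y, linear (fun z => br x y z);
  br_skew : forall (s : 'S_3) (x : 'I_3 -> A),
    br (x (s (inord 0))) (x (s (inord 1))) (x (s (inord 2))) =
    (-1) ^+ s *: br (x (inord 0)) (x (inord 1)) (x (inord 2));
  hom_nambu_filippov : forall x1 x2 y1 y2 y3,
    br (twist x1) (twist x2) (br y1 y2 y3) =
      br (br x1 x2 y1) (twist y2) (twist y3)
      + br (twist y1) (br x1 x2 y2) (twist y3)
      + br (twist y1) (twist y2) (br x1 x2 y3)
}.

Section Series.
Variables (K : fieldType) (A : lmodType K).

Definition lspan (S : set A) : set A :=
  [set v | exists (n : nat) (a : 'I_n -> K) (s : 'I_n -> A),
     (forall i, S (s i)) /\ v = \sum_(i < n) a i *: s i].

Variable L : hom_lie3 A.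

Definition bracket_span (X Y Z : set A) : set A :=
  lspan [set w | exists x y z, [/\ X x, Y y, Z z & w = br L x y z]].

(* D_k^r: the first k slots hold D_k^(r-1), the remaining 3 - k hold A. *)
Fixpoint derived (k r : nat) : set A :=
  if r is r'.+1 then
    let slot i := if (i < k)%N then derived k r' else setT in
    bracket_span (slot 0%N) (slot 1%N) (slot 2%N)
  else setT.

Definition solvable (k : nat) : Prop := exists r, derived k r = [set 0].

Definition solvable_of_class (k r : nat) : Prop :=
  derived k r = [set 0] /\ forall s, (s < r)%N -> derived k s <> [set 0].

Fixpoint central_descending (r : nat) : set A :=
  if r is r'.+1 then bracket_span (central_descending r') setT setT else setT.

Definition nilpotent : Prop := exists r, central_descending r = [set 0].

Definition center : set A := [set z | forall x y, br L x y z = 0].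

End Series.

Definition has_dim (K : fieldType) (A : vectType K) (S : set A) (n : nat) :=
  exists2 U : {vspace A}, S = [set` U] & \dim U = n.

Definition class_4_3_N2_6 (K : fieldType) (A : vectType K) (L : hom_lie3 A)
    (e : 'I_4 -> A) (c124 c134 : 'I_4 -> K) : Prop :=
  [/\ basis_of fullv [tuple e i | i < 4],
      [/\ twist L (e i1) = 0, twist L (e i2) = 0,
          twist L (e i3) = e i2 & twist L (e i4) = e i3] &
      [/\ br L (e i1) (e i2) (e i3) = 0,
          br L (e i1) (e i2) (e i4) = \sum_(p < 4) c124 p *: e p,
          br L (e i1) (e i3) (e i4) = \sum_(p < 4) c134 p *: e p &
          br L (e i2) (e i3) (e i4) = 0]].

Section Matrices.
Variables (K : fieldType) (c124 c134 : 'I_4 -> K).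

Definition bracket_mx : 'M[K]_4 :=
  \matrix_(p < 4, j < 4) [:: 0; c134 p; - c124 p; 0]`_j.

Definition dminor (p q : 'I_4) : K := c124 p * c134 q - c124 q * c134 p.

Definition dminor_mx : 'M[K]_2 :=
  \matrix_(i < 2, j < 2)
    (nth [::] [:: [:: dminor i2 i4; dminor i3 i4];
                  [:: dminor i1 i2; dminor i1 i3]] i)`_j.

End Matrices.

(* Main.v *)
(** Write [u = [e1,e2,e4]] and [v = [e1,e3,e4]]. In coordinates the bracket is
    [[x,y,z] = D124 u + D134 v], with [Dijk] the 3x3 minor of the coordinates of
    [x, y, z], so that [[A,A,A] = <u, v>]. Hence [D_3^2] is spanned by minors of
    three vectors of a plane and vanishes, while [D_2^2 = <[u,v,e_k]>] is spanned
    by [d24 u + d34 v], [d14 u], [d14 v] and [d12 u + d13 v]. If [d14 <> 0] the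
    2-derived series is stuck at [<u, v>]; if [d14 = 0] then [D_2^2] is the image
    of [M], and [D_2^3] is spanned by multiples of [det M = d14 d23 = 0].
    An element [z] is central iff [z1 = z4 = 0] and [z2 u + z3 v = 0], which settles
    the center. With a zero center the descending series can never reach [0];
    when [u] and [v] span a line, that line is either central or stable under
    the series. *)
Require Import Defs.
From HB Require Import structures.
From mathcomp Require Import all_boot all_order all_fingroup all_algebra.
From mathcomp Require Import boolp classical_sets.
From mathcomp Require Import ring.

Set Implicit Arguments.
Unset Strict Implicit.
Unset Printing Implicit Defensive.

Import GRing.Theory.
Local Open Scope ring_scope.
Local Open Scope classical_set_scope.

(** * Case analysis and sums over four indices *)

Lemma ord4_ind (P : 'I_4 -> Prop) :
  P i1 -> P i2 -> P i3 -> P i4 -> forall i, P i.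
Proof.
move=> P1 P2 P3 P4 [[|[|[|[|m]]]] lt_m] //.
- by rewrite (_ : Ordinal _ = i1) //; apply: val_inj.
- by rewrite (_ : Ordinal _ = i2) //; apply: val_inj.
- by rewrite (_ : Ordinal _ = i3) //; apply: val_inj.
- by rewrite (_ : Ordinal _ = i4) //; apply: val_inj.
Qed.

Lemma big_ord4 (V : nmodType) (F : 'I_4 -> V) :
  \sum_(i < 4) F i = F i1 + F i2 + F i3 + F i4.
Proof.
rewrite !big_ord_recr big_ord0 /= add0r.
by congr (F _ + F _ + F _ + F _); apply: val_inj.
Qed.

(** * Linear spans of sets compared with [{vspace A}] *)

Section LinearSpan.
Context {K : fieldType} {A : vectType K}.
Implicit Types (S : set A) (U : {vspace A}).

Lemma lspan_scale S a x : S x -> lspan S (a *: x).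
Proof.
by move=> Sx; exists 1%N, (fun=> a), (fun=> x); split=> //; rewrite big_ord1.
Qed.

Lemma sub_lspan S : S `<=` lspan S.
Proof. by move=> x Sx; rewrite -[x]scale1r; apply: lspan_scale. Qed.

Lemma lspan_sub S U : S `<=` [set` U] -> lspan S `<=` [set` U].
Proof.
move=> sSU _ [n [a [s [Ss ->]]]] /=.
by apply: memv_suml => i _; rewrite memvZ //; apply: sSU.
Qed.

Lemma lspan_eq_span S (X : seq A) :
  S `<=` [set` <<X>>%VS] -> (forall x, x \in X -> S x) ->
  lspan S = [set` <<X>>%VS].
Proof.
move=> sSX sXS; apply/seteqP; split; first exact: lspan_sub.
move=> x /= /(@coord_span _ _ _ (in_tuple X)) ->.
exists (size X), (fun i => coord (in_tuple X) i x), (fun i => X`_i).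
by split=> // i; apply/sXS/mem_nth.
Qed.

Lemma lspan_sub0 S : S `<=` [set 0] -> S !=set0 -> lspan S = [set 0].
Proof.
move=> sS0 [x Sx]; apply/seteqP; split=> [|_ ->]; last first.
  by have <- : x = 0 := sS0 _ Sx; apply: sub_lspan.
move=> _ [n [a [s [Ss ->]]]] /=.
by apply: big1 => i _; rewrite (sS0 _ (Ss i)) scaler0.
Qed.

Lemma mem_span2 (x y z : A) :
  z \in <<[:: x; y]>>%VS -> exists a b, z = a *: x + b *: y.
Proof.
rewrite span_cons span_seq1.
by move=> /memv_addP[_ /vlineP[a ->] [_ /vlineP[b ->] ->]]; exists a, b.
Qed.

Lemma span2_mem (x y : A) a b : a *: x + b *: y \in <<[:: x; y]>>%VS.
Proof. by rewrite memvD ?memvZ ?memv_span ?inE ?eqxx ?orbT. Qed.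

Lemma lspan_set1 (x : A) : lspan [set x] = [set` <[x]>%VS].
Proof.
rewrite -span_seq1; apply: lspan_eq_span => [_ ->|y].
  by rewrite /= memv_span1.
by rewrite inE => /eqP.
Qed.

End LinearSpan.

(** * Consequences of skew-symmetry and trilinearity *)

Section TrilinearBracket.
Context {K : fieldType} {A : vectType K} (charK0 : [pchar K] =i pred0).
Context (L : hom_lie3 A).
Local Notation "[ x , y , z ]" := (br L x y z).

Lemma br_swap12 x y z : [y, x, z] = - [x, y, z].
Proof.
pose s : 'S_3 := tperm (inord 0) (inord 1).
have := br_skew L s (fun i => [:: x; y; z]`_i).
rewrite tpermL tpermR tpermD -?val_eqE /= ?inordK //=.
by rewrite odd_tperm -val_eqE /= !inordK //= expr1 scaleN1r.
Qed.

Lemma br_swap23 x y z : [x, z, y] = - [x, y, z].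
Proof.
pose s : 'S_3 := tperm (inord 1) (inord 2).
have := br_skew L s (fun i => [:: x; y; z]`_i).
rewrite tpermL tpermR tpermD -?val_eqE /= ?inordK //=.
by rewrite odd_tperm -val_eqE /= !inordK //= expr1 scaleN1r.
Qed.

Lemma br_rot x y z : [y, z, x] = [x, y, z].
Proof. by rewrite br_swap23 br_swap12 opprK. Qed.

(** Characteristic 0 enters here: 2 is invertible, so a skew-symmetric bracket is alternating. *)
Lemma eq_oppr_eq0 (x : A) : x = - x -> x = 0.
Proof.
move=> /eqP; rewrite -subr_eq0 opprK -mulr2n -scaler_nat scaler_eq0.
by rewrite (pcharf0P K).1 // => /orP[//|/eqP].
Qed.

Lemma br_alt12 x z : [x, x, z] = 0.
Proof. exact/eq_oppr_eq0/br_swap12. Qed.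

Lemma br_alt23 x z : [x, z, z] = 0.
Proof. exact/eq_oppr_eq0/br_swap23. Qed.

Lemma br_alt13 x z : [x, z, x] = 0.
Proof. by rewrite br_swap23 br_alt12 oppr0. Qed.

Lemma br_scale1 a x y z : [a *: x, y, z] = a *: [x, y, z].
Proof.
have lin := br_linear1 L y z.
have br0 : [0, y, z] = 0.
  have := lin (-1) 0 0; rewrite scaler0 addr0 scaleN1r addNr; exact.
by have := lin a x 0; rewrite !addr0 br0 addr0.
Qed.

(** An alternating form on a plane is a determinant. This reduces brackets with two entries in the
    plane of [u] and [v] to [[u, v, z]]. *)
Lemma br_comb2 a b a' b' x y z :
  [a *: x + b *: y, a' *: x + b' *: y, z] = (a * b' - b * a') *: [x, y, z].
Proof.
have scale2 c x1 y1 : [x1, c *: y1, z] = c *: [x1, y1, z].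
  by rewrite br_swap12 br_scale1 -scalerN -br_swap12.
have comb2 x1 : [x1, a' *: x + b' *: y, z] = a' *: [x1, x, z] + b' *: [x1, y, z].
  by rewrite br_linear2 scale2.
rewrite br_linear1 br_scale1 !comb2 !br_alt12 !scaler0 add0r addr0 !scalerA.
by rewrite (br_swap12 x y) scalerN scalerBl.
Qed.

Lemma sub_bracket_span (X Y Z : set A) x y z :
  X x -> Y y -> Z z -> bracket_span L X Y Z [x, y, z].
Proof. by move=> Xx Yy Zz; apply: sub_lspan; exists x, y, z. Qed.

Lemma bracket_span_eq0 (X Y Z : set A) : X 0 -> Y 0 -> Z 0 ->
  (forall x y z, X x -> Y y -> Z z -> [x, y, z] = 0) ->
  bracket_span L X Y Z = [set 0].
Proof.
move=> X0 Y0 Z0 br0; apply: lspan_sub0.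
  by move=> _ [x [y [z [Xx Yy Zz ->]]]]; apply: br0.
by exists [0, 0, 0], 0, 0, 0.
Qed.

End TrilinearBracket.

(** * The minors [d p q] and the ranks of [B] and [M] *)

Section StructureConstants.
Context {K : fieldType} (c124 c134 : 'I_4 -> K).
Local Notation B := (bracket_mx c124 c134).
Local Notation d := (dminor c124 c134).
Local Notation M := (dminor_mx c124 c134).

Lemma dminorC p q : d q p = - d p q.
Proof. by rewrite /dminor; ring. Qed.

Lemma dminorxx p : d p p = 0.
Proof. by rewrite /dminor; ring. Qed.

Lemma dminor_eq0 :
  (forall p q : 'I_4, (p < q)%N -> d p q = 0) -> forall p q, d p q = 0.
Proof.
move=> d0 p q; case: (ltngtP p q) => [/d0//|/d0 dqp|/val_inj ->].
  by rewrite dminorC dqp oppr0.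
exact: dminorxx.
Qed.

Lemma dminor_neq0P :
  (exists p q, d p q != 0) <-> exists p q : 'I_4, (p < q)%N /\ d p q != 0.
Proof.
split=> [[p [q dpq]]|[p [q [_ dpq]]]]; last by exists p, q.
case: (ltngtP p q) => [pq|qp|/val_inj pq].
- by exists p, q.
- by exists q, p; split; rewrite // dminorC oppr_eq0.
- by move: dpq; rewrite pq dminorxx eqxx.
Qed.

(* The Plücker relation [d12 d34 - d13 d24 + d14 d23 = 0]. *)
Lemma det_dminor_mx : \det M = d i1 i4 * d i2 i3.
Proof.
rewrite (expand_det_row _ 0) big_ord_recl big_ord1 /cofactor !det_mx11 !mxE /=.
by rewrite /dminor; ring.
Qed.

Lemma dminor_mx_eq0 : M = 0 <->
  [/\ d i2 i4 = 0, d i3 i4 = 0, d i1 i2 = 0 & d i1 i3 = 0].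
Proof.
split=> [M0|[d24 d34 d12 d13]].
  by split; [have /matrixP/(_ 0 0) := M0|have /matrixP/(_ 0 1) := M0
    |have /matrixP/(_ 1 0) := M0|have /matrixP/(_ 1 1) := M0]; rewrite !mxE.
by apply/matrixP=> [[[|[|i]] lti]] [[|[|j]] ltj] //; rewrite !mxE.
Qed.

Lemma bracket_mx_eq0 : B = 0 <-> forall p, c124 p = 0 /\ c134 p = 0.
Proof.
split=> [/matrixP B0 p|c0].
  have := B0 p i3; have := B0 p i2; rewrite !mxE /= => -> /eqP.
  by rewrite oppr_eq0 => /eqP.
apply/matrixP=> p j; rewrite !mxE; have [-> ->] := c0 p.
by rewrite oppr0; elim/ord4_ind: j.
Qed.

Lemma bracket_mx_neq0 : B != 0 -> exists p, c124 p != 0 \/ c134 p != 0.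
Proof.
move=> B0; apply: contrapT => c0; case/eqP: B0; apply/bracket_mx_eq0 => p.
by split; apply/eqP; apply: contra_notT c0 => cp; exists p; [left|right].
Qed.

(** The rows are the coordinates of [u] and [v], so its maximal minors are the [d p q]; its rank is
    visibly at most 2. *)
Definition structure_rows : 'M[K]_(2, 4) :=
  \matrix_(i < 2, p < 4) [:: c124 p; c134 p]`_i.

Lemma mul_structure_rows (x : 'rV[K]_2) p :
  (x *m structure_rows) 0 p = x 0 0 * c124 p + x 0 1 * c134 p.
Proof.
rewrite !mxE big_ord_recl big_ord1 !mxE.
by congr (x _ _ * _ + x _ _ * _); apply: val_inj.
Qed.

Lemma rank_bracket_mx : \rank B = \rank structure_rows.
Proof.
rewrite -mxrank_tr; apply/eqP; rewrite eqn_leq.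
(* [E] produces the rows of [B^T] from the two structure rows, and [F] recovers these from rows 2
   and 3 of [B^T], undoing the sign. Each matrix is thus a left multiple of the other. *)
pose E : 'M[K]_(4, 2) :=
  \matrix_(j < 4, i < 2) [:: 0; (i == 1)%:R; - (i == 0)%:R; 0]`_j.
pose F : 'M[K]_(2, 4) :=
  \matrix_(i < 2, j < 4) [:: - (j == i3)%:R; (j == i2)%:R]`_i.
have -> : B^T = E *m structure_rows.
  apply/matrixP=> j p; rewrite !mxE big_ord_recl big_ord1 !mxE /=.
  by elim/ord4_ind: j => /=; ring.
have FE : structure_rows = F *m (E *m structure_rows).
  apply/matrixP=> i p; rewrite !mxE big_ord4 !mxE !big_ord_recl !big_ord0 !mxE /=.
  by case: i => [[|[|i]] lti] //=; ring.
by rewrite mxrankM_maxr {1}FE mxrankM_maxr.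
Qed.

(** Cramer's rule on columns [p] and [q]: one nonzero minor makes [u] and [v] independent. *)
Lemma dminor_free p q a b : d p q != 0 ->
  (forall r, a * c124 r + b * c134 r = 0) -> a = 0 /\ b = 0.
Proof.
move=> dpq comb0; split; apply: (mulIf dpq); rewrite mul0r.
  have -> : a * d p q = (a * c124 p + b * c134 p) * c134 q
                      - (a * c124 q + b * c134 q) * c134 p by rewrite /dminor; ring.
  by rewrite !comb0 !mul0r subrr.
have -> : b * d p q = (a * c124 q + b * c134 q) * c124 p
                    - (a * c124 p + b * c134 p) * c124 q by rewrite /dminor; ring.
by rewrite !comb0 !mul0r subrr.
Qed.

(** When all minors vanish, every column [(c124 q, c134 q)] is proportional to the nonzero column at
    [p], so a relation at [p] spreads to all indices. *)
Lemma dminor_comb_eq0 p a b : (forall p q, d p q = 0) ->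
  c124 p != 0 \/ c134 p != 0 -> a * c124 p + b * c134 p = 0 ->
  forall q, a * c124 q + b * c134 q = 0.
Proof.
move=> d0 [] cp comb0 q; apply: (mulIf cp); rewrite mul0r.
  have -> : (a * c124 q + b * c134 q) * c124 p
          = (a * c124 p + b * c134 p) * c124 q + b * d p q by rewrite /dminor; ring.
  by rewrite comb0 d0 mul0r mulr0 addr0.
have -> : (a * c124 q + b * c134 q) * c134 p
        = (a * c124 p + b * c134 p) * c134 q - a * d p q by rewrite /dminor; ring.
by rewrite comb0 d0 mul0r mulr0 subr0.
Qed.

Lemma rank_bracket_mx2P : \rank B = 2%N <-> exists p q, d p q != 0.
Proof.
rewrite rank_bracket_mx; split=> [rk2|[p [q dpq]]].
  apply: contrapT => d0.
  have {}d0 p q : d p q = 0.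
    by apply/eqP; apply: contra_notT d0 => dpq; exists p, q.
  have inj0 (x : 'rV_2) : x *m structure_rows = 0 -> x = 0.
    move=> x0; apply: (row_free_inj (A := structure_rows)); first exact/eqP.
    by rewrite mul0mx.
  have c0 p : c124 p = 0 /\ c134 p = 0.
    (* Entry [q] of this row times [structure_rows] is the minor [d q p], which vanishes; full row
       rank then kills the row itself. *)
    have /matrixP x0 : (\row_(i < 2) [:: c134 p; - c124 p]`_i) = 0.
      apply: inj0; apply/rowP => q; rewrite mul_structure_rows !mxE /=.
      by rewrite -(d0 q p) /dminor; ring.
    have := x0 0 0; have /eqP := x0 0 1; rewrite !mxE /= oppr_eq0 => /eqP.
    by split.
  suff S0 : structure_rows = 0 by move: rk2; rewrite S0 mxrank0.
  apply/matrixP=> i p; rewrite !mxE; have [-> ->] := c0 p.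
  by case: i => [[|[|]]].
apply/eqP; rewrite -/(row_free _); apply: inj_row_free => x x0.
have [] := @dminor_free p q (x 0 0) (x 0 1) dpq.
  by move=> r; rewrite -mul_structure_rows x0 mxE.
move=> x00 x01; apply/rowP => j; rewrite mxE.
by case: j => [[|[|j]] ltj] //; [rewrite -x00|rewrite -x01];
  congr (x _ _); apply: val_inj.
Qed.

Lemma rank_bracket_mx1P : B != 0 -> \rank B = 1%N <-> forall p q, d p q = 0.
Proof.
move=> B0; split=> [rk1 p q|d0].
  apply: contraPeq rk1 => dpq.
  by have -> : \rank B = 2%N by apply/rank_bracket_mx2P; exists p, q.
have rk_neq2 : \rank B <> 2%N.
  by move=> /rank_bracket_mx2P [p [q]]; rewrite d0 eqxx.
have rk_le2 : (\rank B <= 2)%N by rewrite rank_bracket_mx rank_leq_row.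
by move: B0 rk_neq2 rk_le2; rewrite -mxrank_eq0; case: (\rank B) => [|[|[|]]].
Qed.

Lemma rank_dminor_mx_lt2P : (\rank M < 2)%N <-> \det M = 0.
Proof.
rewrite ltn_neqAle rank_leq_row andbT -[_ == _]/(row_free M) row_free_unit.
by rewrite unitmxE unitfE negbK; split=> [/eqP|->].
Qed.

Lemma dminor_mx_dependentP :
  (exists l l' : K, [/\ (l, l') != (0, 0),
     l * d i2 i4 + l' * d i1 i2 = 0 & l * d i3 i4 + l' * d i1 i3 = 0])
  <-> \det M = 0.
Proof.
(* The pair of coefficients is a vector of the left kernel of [M], which is what [det0P] speaks
   of. *)
have mulM (v : 'rV[K]_2) : v *m M = 0 <->
    v 0 0 * d i2 i4 + v 0 1 * d i1 i2 = 0 /\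
    v 0 0 * d i3 i4 + v 0 1 * d i1 i3 = 0.
  have vM j : (v *m M) 0 j = v 0 0 * M 0 j + v 0 1 * M 1 j.
    rewrite mxE big_ord_recl big_ord1.
    by congr (v _ _ * M _ _ + v _ _ * M _ _); apply: val_inj.
  split=> [/matrixP vM0|[v0 v1]].
    by split; [have := vM0 0 0|have := vM0 0 1]; rewrite vM !mxE.
  apply/rowP=> j; rewrite vM !mxE /=.
  by case: j => [[|[|j]] ltj].
split=> [[l [l' [ll' l1 l2]]]|/eqP/det0P[v v0 /mulM[v1 v2]]].
  apply/eqP/det0P; exists (\row_(i < 2) [:: l; l']`_i).
    apply: contraNneq ll' => /matrixP v0.
    by have := v0 0 0; have := v0 0 1; rewrite !mxE /= => -> ->.
  by apply/mulM; rewrite !mxE.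
exists (v 0 0), (v 0 1); split=> //; apply: contraNneq v0 => -[v00 v01].
apply/eqP/rowP => j; rewrite mxE.
by case: j => [[|[|j]] ltj] //; [rewrite -v00|rewrite -v01];
  congr (v _ _); apply: val_inj.
Qed.

End StructureConstants.

(** * The bracket in coordinates and the first derived terms *)

Section Class4_3_N2_6.
Context {K : fieldType} {A : vectType K} (charK0 : [pchar K] =i pred0).
Context {L : hom_lie3 A} {e : 'I_4 -> A} {c124 c134 : 'I_4 -> K}.
Context (classL : class_4_3_N2_6 L e c124 c134).
Local Notation "[ x , y , z ]" := (br L x y z).
Local Notation B := (bracket_mx c124 c134).
Local Notation d := (dminor c124 c134).
Local Notation M := (dminor_mx c124 c134).
Local Notation co := (coord [tuple e i | i < 4]).
Let u := \sum_(p < 4) c124 p *: e p.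
Let v := \sum_(p < 4) c134 p *: e p.

Let basis_e : basis_of fullv [tuple e i | i < 4].
Proof. by case: classL. Qed.

Lemma nth_e (i : 'I_4) : [tuple e i | i < 4]`_i = e i.
Proof. by rewrite -tnth_nth tnth_mktuple. Qed.

Lemma sum_co x : x = \sum_i co i x *: e i.
Proof.
rewrite {1}(coord_basis basis_e (memvf x)).
by apply: eq_bigr => i _; rewrite nth_e.
Qed.

Lemma co_sum (k : 'I_4 -> K) i : co i (\sum_j k j *: e j) = k i.
Proof.
rewrite -[RHS](coord_sum_free k i (basis_free basis_e)).
by congr (coord _ i _); apply: eq_bigr => j _; rewrite nth_e.
Qed.

Lemma co_e i j : co i (e j) = (j == i)%:R.
Proof. by rewrite -[e j]nth_e coord_free ?(basis_free basis_e). Qed.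

Lemma co_eq0 x : (forall i, co i x = 0) -> x = 0.
Proof. by move=> x0; rewrite (sum_co x) big1 // => i _; rewrite x0 scale0r. Qed.

Lemma linear_eq_basis (f g : A -> A) : linear f -> linear g ->
  (forall i, f (e i) = g (e i)) -> f =1 g.
Proof.
move=> linf ling fg x; rewrite (sum_co x).
have lin0 h : linear h -> h 0 = 0 :> A.
  by move=> linh; have := linh (-1) 0 0; rewrite scaler0 addr0 scaleN1r addNr.
elim/big_rec: _ => [|i y _ fgy]; first by rewrite !lin0.
by rewrite linf ling fg fgy.
Qed.

Definition det3 i j k x y z : K :=
  co i x * (co j y * co k z - co k y * co j z)
  - co j x * (co i y * co k z - co k y * co i z)
  + co k x * (co i y * co j z - co j y * co i z).

(** Both sides are linear in each slot, so the slots are reduced to basis vectors one after the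
    other. *)
Lemma brE x y z :
  [x, y, z] = det3 i1 i2 i4 x y z *: u + det3 i1 i3 i4 x y z *: v.
Proof.
have lin_comb (f g : A -> K) : scalar f -> scalar g ->
    linear (fun w => f w *: u + g w *: v).
  move=> linf ling a s t; rewrite linf ling scalerDr !scalerA addrACA.
  by rewrite -!scalerDl.
apply: (@linear_eq_basis (fun x => [x, y, z])
  (fun x => det3 i1 i2 i4 x y z *: u + det3 i1 i3 i4 x y z *: v)).
- exact: br_linear1.
- by apply: lin_comb => a s t; rewrite /det3 !linearP /=; ring.
move=> i; apply: (@linear_eq_basis (fun y => [e i, y, z])
  (fun y => det3 i1 i2 i4 (e i) y z *: u + det3 i1 i3 i4 (e i) y z *: v)).
- exact: br_linear2.
- by apply: lin_comb => a s t; rewrite /det3 !linearP /=; ring.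
move=> j; apply: (@linear_eq_basis (fun z => [e i, e j, z])
  (fun z => det3 i1 i2 i4 (e i) (e j) z *: u + det3 i1 i3 i4 (e i) (e j) z *: v)).
- exact: br_linear3.
- by apply: lin_comb => a s t; rewrite /det3 !linearP /=; ring.
move=> k; rewrite /det3 !co_e {x y z}.
case: classL => _ _ [e123 e124 e134 e234].
have s12 := br_swap12 L; have s23 := br_swap23 L.
(* Rewriting with [sort] puts the arguments of a basic bracket in order. *)
have sort := (s12 (e i1) (e i2), s12 (e i1) (e i3), s12 (e i1) (e i4),
  s12 (e i2) (e i3), s12 (e i2) (e i4), s12 (e i3) (e i4),
  s23 (e i1) (e i2) (e i3), s23 (e i1) (e i2) (e i4), s23 (e i1) (e i3) (e i4),
  s23 (e i2) (e i1) (e i3), s23 (e i2) (e i1) (e i4), s23 (e i2) (e i3) (e i4),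
  s23 (e i3) (e i1) (e i4), s23 (e i3) (e i2) (e i4)).
(* Of the 64 index triples, those with a repetition vanish by alternation; the others reduce to the
   four given brackets up to sign. *)
elim/ord4_ind: i; elim/ord4_ind: j; elim/ord4_ind: k; rewrite /=.
all: rewrite ?(br_alt12 charK0, br_alt23 charK0, br_alt13 charK0).
all: rewrite ?sort ?opprK ?e123 ?e124 ?e134 ?e234.
all: do 2!rewrite ?(mul0r, mulr0, mul1r, mulr1, subr0, sub0r, addr0, add0r)
  ?(oppr0, opprK).
all: by rewrite ?(scale0r, scale1r, scaleN1r, addr0, add0r).
Qed.

Lemma co_u i : co i u = c124 i. Proof. exact: co_sum. Qed.
Lemma co_v i : co i v = c134 i. Proof. exact: co_sum. Qed.

Lemma comb_uv_eq0 a b :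
  a *: u + b *: v = 0 <-> forall p, a * c124 p + b * c134 p = 0.
Proof.
have co_comb p : co p (a *: u + b *: v) = a * c124 p + b * c134 p.
  by rewrite linearP linearZ /= co_u co_v.
split=> [uv0 p|c0]; first by rewrite -co_comb uv0 linear0.
by apply: co_eq0 => p; rewrite co_comb.
Qed.

(** The two 3x3 minors are expanded along the row of [z]; the cofactors are the [d p q]. *)
Lemma br_uv z : [u, v, z] =
  co i1 z *: (d i2 i4 *: u + d i3 i4 *: v)
  - d i1 i4 *: (co i2 z *: u + co i3 z *: v)
  + co i4 z *: (d i1 i2 *: u + d i1 i3 *: v).
Proof.
have combD a b a' b' : (a *: u + b *: v) + (a' *: u + b' *: v)
    = (a + a') *: u + (b + b') *: v by rewrite addrACA -!scalerDl.
rewrite -scaleNr !scalerDr !scalerA !combD brE /det3 !co_u !co_v /dminor.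
by congr (_ *: _ + _ *: _); ring.
Qed.

Lemma derived1 k : derived L k 1 = [set` <<[:: u; v]>>%VS].
Proof.
case: classL => _ _ [_ e124 e134 _].
(* At the first step every slot is the whole space, whichever branch of the conditional on [k] is
   taken. *)
suff span_eq X Y Z : X = setT -> Y = setT -> Z = setT ->
    bracket_span L X Y Z = [set` <<[:: u; v]>>%VS].
  by apply: span_eq => /=; case: ifP.
move=> -> -> ->; apply: lspan_eq_span.
  by move=> _ [x [y [z [_ _ _ ->]]]]; rewrite /= brE span2_mem.
move=> x; rewrite !inE => /orP[] /eqP ->.
  by exists (e i1), (e i2), (e i4).
by exists (e i1), (e i3), (e i4).
Qed.

Lemma derived0 k r : derived L k r 0.
Proof.
case: r => [|r] //=; exists 0%N, (fun=> 0), (fun=> 0).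
by split=> [[]|]; rewrite ?big_ord0.
Qed.

Lemma derived2S r :
  derived L 2 r.+1 = bracket_span L (derived L 2 r) (derived L 2 r) setT.
Proof. by []. Qed.

Lemma derived3S r :
  derived L 3 r.+1 =
    bracket_span L (derived L 3 r) (derived L 3 r) (derived L 3 r).
Proof. by []. Qed.

Lemma derived1_u k : derived L k 1 u.
Proof. by rewrite derived1; apply/memv_span/mem_head. Qed.

Lemma derived1_v k : derived L k 1 v.
Proof. by rewrite derived1; apply: memv_span; rewrite !inE eqxx orbT. Qed.

Lemma br_span2_eq0 x y z : (forall t, [u, v, t] = 0) ->
  x \in <<[:: u; v]>>%VS -> y \in <<[:: u; v]>>%VS -> [x, y, z] = 0.
Proof.
move=> uv0 /mem_span2[a [b ->]] /mem_span2[a' [b' ->]].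
by rewrite br_comb2 // uv0 scaler0.
Qed.

Lemma derived2_eq0 : (forall z, [u, v, z] = 0) -> derived L 2 2 = [set 0].
Proof.
move=> uv0; rewrite derived2S; apply: bracket_span_eq0 => //;
  try exact: derived0.
rewrite derived1 => x y z xD yD _.
exact: br_span2_eq0.
Qed.

Lemma derived3_eq0 : derived L 3 2 = [set 0].
Proof.
rewrite derived3S; apply: bracket_span_eq0; try exact: derived0.
rewrite derived1 => x y z /mem_span2[a [b ->]] /mem_span2[a' [b' ->]].
move=> /mem_span2[a2 [b2 ->]].
rewrite brE /det3 !linearP !linearZ /= !co_u !co_v.
(* Three vectors of one plane have dependent coordinate rows, so both minors are identically
   zero. *)
rewrite [X in X *: u](_ : _ = 0); last by ring.
by rewrite [X in X *: v](_ : _ = 0) ?scale0r ?addr0 //; ring.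
Qed.

(** * Solvability and the center when [B] is nonzero *)

Section NonzeroBracket.
Context (B_neq0 : B != 0).

Lemma uv_neq0 : ~ (u = 0 /\ v = 0).
Proof.
case=> u0 v0; case/eqP: B_neq0; apply/bracket_mx_eq0 => p.
by rewrite -co_u -co_v u0 v0 linear0.
Qed.

(** The terms of index 0 and 1 contain [u] and [v], not both zero. This is the lower bound 2 on
    every solvability class. *)
Lemma derived_neq0 k s : (s < 2)%N -> derived L k s <> [set 0].
Proof.
case: s => [|[|//]] _ D0; apply: uv_neq0.
  by split; [have : [set 0] u by rewrite -D0 | have : [set 0] v by rewrite -D0].
by split; [have := derived1_u k | have := derived1_v k]; rewrite D0.
Qed.

Lemma solvable3_class2 : solvable_of_class L 3 2.
Proof. by split; [exact: derived3_eq0 | exact: derived_neq0]. Qed.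

(** Bracketing [u] and [v] with [e i2] and [e i3] returns [u] and [v], up to the invertible factor
    [- d i1 i4]. *)
Lemma derived2_stable r : d i1 i4 != 0 -> derived L 2 r u /\ derived L 2 r v.
Proof.
move=> d14; elim: r => [//|r [Du Dv]].
have uv2 : [u, v, e i2] = - d i1 i4 *: u.
  by rewrite br_uv !co_e /= !scale0r scale1r !addr0 !add0r scaleNr.
have uv3 : [u, v, e i3] = - d i1 i4 *: v.
  by rewrite br_uv !co_e /= !scale0r scale1r !addr0 !add0r scaleNr.
have Nd14 : - d i1 i4 != 0 by rewrite oppr_eq0.
split.
  have -> : u = (- d i1 i4)^-1 *: [u, v, e i2].
    by rewrite uv2 scalerA mulVf ?scale1r.
  by apply: lspan_scale; exists u, v, (e i2).
have -> : v = (- d i1 i4)^-1 *: [u, v, e i3].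
  by rewrite uv3 scalerA mulVf ?scale1r.
by apply: lspan_scale; exists u, v, (e i3).
Qed.

Lemma derived2_3_eq0 : d i1 i4 = 0 -> derived L 2 3 = [set 0].
Proof.
move=> d14.
pose s := d i2 i4 *: u + d i3 i4 *: v; pose t := d i1 i2 *: u + d i1 i3 *: v.
have D2 : derived L 2 2 `<=` [set` <<[:: s; t]>>%VS].
  rewrite derived2S derived1.
  apply: lspan_sub => _ [x [y [z [+ + _ ->]]]].
  move=> /mem_span2[a [b ->]] /mem_span2[a' [b' ->]].
  rewrite br_comb2 // br_uv d14 scale0r subr0.
  by apply: memvZ; apply: span2_mem.
rewrite derived2S; apply: bracket_span_eq0 => //; try exact: derived0.
move=> x y z /D2/mem_span2[a [b ->]] /D2/mem_span2[a' [b' ->]] _.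
(* The rows of [M] are the coefficients of [s] and [t] on [u] and [v], so a second use of [br_comb2]
   yields the factor [\det M]. *)
have -> : [a *: s + b *: t, a' *: s + b' *: t, z] =
    ((a * b' - b * a') * \det M) *: [u, v, z].
  rewrite 2?br_comb2 // scalerA det_dminor_mx /dminor.
  by congr (_ *: _); ring.
by rewrite det_dminor_mx d14 mul0r mulr0 scale0r.
Qed.

Lemma solvable2P : solvable L 2 <-> d i1 i4 = 0.
Proof.
split=> [[r Dr]|d14]; last by exists 3%N; exact: derived2_3_eq0.
apply: contrapT => /eqP/(derived2_stable r); rewrite Dr => -[u0 v0].
exact: uv_neq0.
Qed.

Lemma centerP z : center L z <->
  [/\ co i1 z = 0, co i4 z = 0 & co i2 z *: u + co i3 z *: v = 0].
Proof.
have br_zu x y a : det3 i1 i2 i4 x y z = a -> det3 i1 i3 i4 x y z = 0 ->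
    [x, y, z] = a *: u.
  by move=> Du Dv; rewrite brE Du Dv scale0r addr0.
have br_zv x y a : det3 i1 i2 i4 x y z = 0 -> det3 i1 i3 i4 x y z = a ->
    [x, y, z] = a *: v.
  by move=> Du Dv; rewrite brE Du Dv scale0r add0r.
split=> [cz|[z1 z4 z23] x y].
  (* One of [u] and [v] is nonzero. The pairs (e2,e4), (e3,e4) then test [co i1 z], and (e1,e2),
     (e1,e3) test [co i4 z]. *)
  have scale_eq0 a : a *: u = 0 -> a *: v = 0 -> a = 0.
    move=> /eqP; rewrite scaler_eq0 => /orP[/eqP //|/eqP u0] /eqP.
    by rewrite scaler_eq0 => /orP[/eqP //|/eqP v0]; case: uv_neq0.
  split.
  - apply: scale_eq0.
      by rewrite -(br_zu (e i2) (e i4)) // /det3 !co_e /=; ring.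
    by rewrite -(br_zv (e i3) (e i4)) // /det3 !co_e /=; ring.
  - apply: scale_eq0.
      by rewrite -(br_zu (e i1) (e i2)) // /det3 !co_e /=; ring.
    by rewrite -(br_zv (e i1) (e i3)) // /det3 !co_e /=; ring.
  (* Bracketing [z] with (e1,e4) gives the opposite of the wanted combination. *)
  - rewrite -[LHS]opprK opprD -!scaleNr -[RHS]oppr0; congr (- _).
    rewrite -(cz (e i1) (e i4)) brE; congr (_ *: _ + _ *: _);
      by rewrite /det3 !co_e /=; ring.
have -> : [x, y, z] = (co i4 x * co i1 y - co i1 x * co i4 y) *:
    (co i2 z *: u + co i3 z *: v).
  rewrite brE scalerDr !scalerA /det3 z1 z4.
  by congr (_ *: _ + _ *: _); ring.
by rewrite z23 scaler0.
Qed.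

Lemma center_scale a x : center L x -> center L (a *: x).
Proof. by move=> cx y z; rewrite br_rot br_scale1 -br_rot cx scaler0. Qed.

Lemma mem_centerE x : center L x -> forall y z, [x, y, z] = 0.
Proof. by move=> cx y z; rewrite -br_rot cx. Qed.

(** * Rank 2: independent [u] and [v] *)

Section Rank2.
Context {p q : 'I_4} (dpq : d p q != 0).

Lemma center_eq0 : center L = [set 0].
Proof.
apply/seteqP; split=> [z /centerP[z1 z4 /comb_uv_eq0 z23]|_ ->]; last first.
  by apply/centerP; rewrite !linear0 !scale0r addr0.
have [z2 z3] := dminor_free dpq z23.
by apply: co_eq0; elim/ord4_ind.
Qed.

(** If a term of the descending series vanishes, the previous term is central, hence zero. Going
    down to the whole space contradicts [uv_neq0]. *)
Lemma not_nilpotent : ~ nilpotent L.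
Proof.
suff Cr_neq0 r : ~ central_descending L r `<=` [set 0].
  by case=> r Cr; apply: (Cr_neq0 r); rewrite Cr.
elim: r => [C0|r IHr CSr].
  by apply: uv_neq0; split; apply: C0.
apply: IHr => x Cx; rewrite -center_eq0 => y z.
by rewrite br_rot; apply: CSr; apply: sub_bracket_span.
Qed.

Lemma solvable2_class3 : d i1 i4 = 0 -> M != 0 -> solvable_of_class L 2 3.
Proof.
move=> d14 M0; split=> [|[|[|[|//]]] _]; do ?exact: derived_neq0.
  exact: derived2_3_eq0.
move=> D2.
have uv0 z : [u, v, z] = 0.
  have : [set 0] [u, v, z]; last by [].
  rewrite -D2 derived2S; apply: sub_bracket_span => //.
    exact: derived1_u.
  exact: derived1_v.
case/eqP: M0; apply/dminor_mx_eq0.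
(* These two brackets are the combinations of [u] and [v] given by the rows of [M], so independence
   forces [M = 0]. *)
have := uv0 (e i1); have := uv0 (e i4).
rewrite !br_uv !co_e /= d14 !scale0r !scale1r !subr0 add0r addr0.
move=> /comb_uv_eq0/(dminor_free dpq)[-> ->].
by move=> /comb_uv_eq0/(dminor_free dpq)[-> ->].
Qed.

End Rank2.

Lemma solvable2_class2 : (forall z, [u, v, z] = 0) -> solvable_of_class L 2 2.
Proof. by move=> uv0; split; [exact: derived2_eq0 | exact: derived_neq0]. Qed.

Lemma br_uv_eq0 : d i1 i4 = 0 -> M = 0 -> forall z, [u, v, z] = 0.
Proof.
move=> d14 /dminor_mx_eq0[d24 d34 d12 d13] z.
by rewrite br_uv d14 d24 d34 d12 d13 !scale0r !addr0 !scaler0 subr0 addr0.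
Qed.

Lemma commutator_span : bracket_span L setT setT setT = [set` <<[:: u; v]>>%VS].
Proof. exact: (derived1 3). Qed.

(** * Rank 1: proportional [u] and [v] *)

Section Rank1.
Context (d0 : forall p q, d p q = 0).
Context {p : 'I_4} (cp : c124 p != 0 \/ c134 p != 0).
(** It is central because [c134 p *: u - c124 p *: v = 0], the coefficient of index [p] being
    zero. *)
Let w := c134 p *: e i2 - c124 p *: e i3.

Lemma rank1_comb_uv_eq0 a b :
  a *: u + b *: v = 0 <-> a * c124 p + b * c134 p = 0.
Proof.
rewrite comb_uv_eq0; split=> [|comb0]; first exact.
exact: dminor_comb_eq0 comb0.
Qed.

Lemma center_vline : center L = [set` <[w]>%VS].
Proof.
have co_w i : co i w = c134 p * (i2 == i)%:R - c124 p * (i3 == i)%:R.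
  by rewrite linearB !linearZ /= !co_e.
apply/seteqP; split=> [z|_ /vlineP[k ->]].
  move=> /centerP[z1 z4 /rank1_comb_uv_eq0 z23] /=.
  apply/vlineP; case: cp => c0.
    (* The factor is read off the coordinate on [e i3], where [w] has [- c124 p]; in the other case
       it is read off [e i2]. *)
    exists (- co i3 z / c124 p).
    apply/eqP; rewrite -subr_eq0; apply/eqP/co_eq0 => i.
    rewrite linearB linearZ /= co_w.
    elim/ord4_ind: i => /=; rewrite ?z1 ?z4; do ?by [ring | field].
    apply: (mulIf c0); rewrite mul0r -z23; field; exact: c0.
  exists (co i2 z / c134 p).
  apply/eqP; rewrite -subr_eq0; apply/eqP/co_eq0 => i.
  rewrite linearB linearZ /= co_w.
  elim/ord4_ind: i => /=; rewrite ?z1 ?z4; do ?by [ring | field].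
  apply: (mulIf c0); rewrite mul0r -z23; field; exact: c0.
apply: center_scale; apply/centerP; rewrite !co_w /=; split; try ring.
by apply/rank1_comb_uv_eq0; ring.
Qed.

Lemma center_gen_neq0 : w != 0.
Proof.
apply/eqP => w0.
have : co i2 w = 0 by rewrite w0 linear0.
have : co i3 w = 0 by rewrite w0 linear0.
rewrite !linearB !linearZ /= !co_e /= !mulr0 !mulr1 subr0 sub0r => /eqP.
by rewrite oppr_eq0 => /eqP c0 c1; case: cp; rewrite ?c0 ?c1 eqxx.
Qed.

Lemma dim_center : has_dim (center L) 1.
Proof.
exists <[w]>%VS; first exact: center_vline.
by rewrite dim_vline center_gen_neq0.
Qed.

(** The generator [t] is whichever of [u] and [v] has a nonzero coordinate at [p]; the other is a
    multiple of it. *)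
Lemma rank1_commutator_vline :
  exists t, [/\ t != 0, u \in <[t]>%VS & v \in <[t]>%VS].
Proof.
have cuv : c134 p *: u - c124 p *: v = 0.
  by rewrite -scaleNr; apply/rank1_comb_uv_eq0; ring.
case: cp => c1.
  exists u; rewrite memv_line; split=> //.
    by apply: contraNneq c1 => u0; rewrite -co_u u0 linear0.
  apply/vlineP; exists (c134 p / c124 p); apply: (scalerI c1).
  move/eqP: cuv; rewrite subr_eq0 => /eqP <-.
  by rewrite scalerA mulrCA mulfV ?mulr1.
exists v; rewrite memv_line; split=> //.
  by apply: contraNneq c1 => v0; rewrite -co_v v0 linear0.
apply/vlineP; exists (c124 p / c134 p); apply: (scalerI c1).
move/eqP: cuv; rewrite subr_eq0 => /eqP ->.
by rewrite scalerA mulrCA mulfV ?mulr1.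
Qed.

Lemma nilpotent_central : nilpotent L -> center L u /\ center L v.
Proof.
move=> [r Cr].
have [t [t0 /vlineP[a ua] /vlineP[b vb]]] := rank1_commutator_vline.
suff ct : center L t by rewrite ua vb; split; apply: center_scale.
move=> x y; have [k tk] : exists k, [t, x, y] = k *: t.
  by rewrite brE ua vb !scalerA -scalerDl; eexists.
(* A nonzero [k] would keep [t] in every term of the descending series, against nilpotency. *)
have [k0|k0] := eqVneq k 0.
  by rewrite br_rot tk k0 scale0r.
have Ct s : central_descending L s t.
  elim: s => [//|s IHs].
  have -> : t = k^-1 *: [t, x, y] by rewrite tk scalerA mulVf ?scale1r.
  by apply: lspan_scale; exists t, x, y.
by case/eqP: t0; have := Ct r; rewrite Cr.
Qed.

(** The span of [u] and [v] is a nonzero subspace of the line of [w], hence equal to it by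
    dimension. *)
Lemma center_eq_commutator : center L u -> center L v ->
  center L = bracket_span L setT setT setT.
Proof.
rewrite commutator_span center_vline => /= uw vw.
suff /eqP -> : (<<[:: u; v]>> == <[w]>)%VS by [].
rewrite eqEdim dim_vline center_gen_neq0.
apply/andP; split.
  by apply/span_subvP => x; rewrite !inE => /orP[] /eqP ->.
rewrite lt0n dimv_eq0; apply/eqP => uv0; apply: uv_neq0.
by split; apply/eqP; rewrite -memv0 -uv0 memv_span // !inE eqxx ?orbT.
Qed.

(** The first descending term is [[A,A,A]]; once it is central, the second one vanishes. *)
Lemma nilpotent_of_center :
  center L = bracket_span L setT setT setT -> nilpotent L.
Proof.
move=> cE; exists 2%N; apply: bracket_span_eq0 => //.
  rewrite -[bracket_span _ _ _ _]cE; apply/centerP.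
  by rewrite !linear0 !scale0r addr0.
move=> x y z; rewrite -[bracket_span _ _ _ _]cE => cx _ _.
exact: mem_centerE.
Qed.

(** This is [centerP] at [u] and [v], each vector relation being reduced to its entry at [p]. *)
Lemma central_uvP : center L u /\ center L v <->
  [/\ [/\ c124 i1 = 0, c124 i4 = 0, c134 i1 = 0 & c134 i4 = 0],
      c134 p * c124 i3 + c124 p * c124 i2 = 0 &
      c134 p * c134 i3 + c124 p * c134 i2 = 0].
Proof.
have eqC a b : c134 p * b + c124 p * a = a * c124 p + b * c134 p by ring.
rewrite !eqC !centerP !co_u !co_v.
by split=> [[[u1 u4 /rank1_comb_uv_eq0 uu] [v1 v4 /rank1_comb_uv_eq0 vv]]
           |[[u1 u4 v1 v4] /rank1_comb_uv_eq0 uu /rank1_comb_uv_eq0 vv]].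
Qed.

End Rank1.
End NonzeroBracket.
End Class4_3_N2_6.

Theorem theorem1 (K : fieldType) (charK0 : [pchar K] =i pred0)
    (A : vectType K) (L : hom_lie3 A) (e : 'I_4 -> A)
    (c124 c134 : 'I_4 -> K)
    (classL : class_4_3_N2_6 L e c124 c134)
    (B_neq0 : bracket_mx c124 c134 != 0) :
  let B := bracket_mx c124 c134 in
  let d := dminor c124 c134 in
  let M := dminor_mx c124 c134 in
  let rows_dependent := exists l l' : K,
    [/\ (l, l') != (0, 0),
        l * d i2 i4 + l' * d i1 i2 = 0 &
        l * d i3 i4 + l' * d i1 i3 = 0] in
  solvable_of_class L 3 2
  /\ (solvable L 2 <-> d i1 i4 = 0)
  /\ ((d i1 i4 = 0 -> rows_dependent)
      /\ (rows_dependent <-> (\rank M < 2)%N)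
      /\ ((\rank M < 2)%N <-> \det M = 0))
  /\ (\rank B = 2%N <-> exists p q : 'I_4, (p < q)%N /\ d p q != 0)
  /\ (\rank B = 2%N ->
        (center L = [set 0] /\ ~ nilpotent L)
        /\ (solvable L 2 ->
              (M != 0 -> solvable_of_class L 2 3)
              /\ (M = 0 -> solvable_of_class L 2 2)))
  /\ (\rank B = 1%N <-> forall p q : 'I_4, (p < q)%N -> d p q = 0)
  /\ (\rank B = 1%N ->
        solvable_of_class L 2 2
        /\ has_dim (center L) 1
        /\ (exists p : 'I_4, c124 p != 0 \/ c134 p != 0)
        /\ (forall p : 'I_4, c124 p != 0 \/ c134 p != 0 ->
              center L = lspan [set c134 p *: e i2 - c124 p *: e i3])
        /\ (nilpotent L <-> center L = bracket_span L setT setT setT)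
        /\ (forall p : 'I_4, c124 p != 0 \/ c134 p != 0 ->
              (nilpotent L <->
                 [/\ [/\ c124 i1 = 0, c124 i4 = 0, c134 i1 = 0 & c134 i4 = 0],
                     c134 p * c124 i3 + c124 p * c124 i2 = 0 &
                     c134 p * c134 i3 + c124 p * c134 i2 = 0]))).
Proof.
move=> B d M rows_dependent.
have rk2P : \rank B = 2%N <-> exists p q : 'I_4, (p < q)%N /\ d p q != 0.
  by rewrite rank_bracket_mx2P dminor_neq0P.
have rk1P := rank_bracket_mx1P B_neq0.
split; first exact: (solvable3_class2 charK0 classL).
split; first exact: (solvable2P charK0 classL).
split.
  split=> [d14|].
    by apply/dminor_mx_dependentP; rewrite det_dminor_mx -/d d14 mul0r.
  split; last exact: rank_dminor_mx_lt2P.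
  by rewrite rank_dminor_mx_lt2P; apply: dminor_mx_dependentP.
split=> //; split.
  move=> /rk2P[p [q [_ dpq]]]; split.
    split; first exact: (center_eq0 charK0 classL B_neq0 dpq).
    exact: (not_nilpotent charK0 classL B_neq0 dpq).
  move=> /(solvable2P charK0 classL B_neq0) d14; split=> M0.
    exact: (solvable2_class3 charK0 classL B_neq0 dpq).
  apply: (solvable2_class2 charK0 classL B_neq0).
  exact: (br_uv_eq0 charK0 classL).
split; first by rewrite rk1P; split=> [d0 p q _|/dminor_eq0].
move=> /rk1P d0; have [p0 cp0] := bracket_mx_neq0 B_neq0.
have M0 : M = 0 by apply/dminor_mx_eq0; split; apply: d0.
pose u := \sum_p c124 p *: e p; pose v := \sum_p c134 p *: e p.
(* Both nilpotency criteria go through the centrality of [u] and [v]: nilpotency implies it, it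
   implies that the center is [[A,A,A]], and this implies nilpotency. *)
have nilP p : c124 p != 0 \/ c134 p != 0 ->
    (nilpotent L <-> center L u /\ center L v).
  move=> cp; split; first exact: (nilpotent_central charK0 classL d0 cp).
  case=> cu cv; apply: (nilpotent_of_center charK0 classL B_neq0).
  exact: (center_eq_commutator charK0 classL B_neq0 d0 cp).
split.
  apply: (solvable2_class2 charK0 classL B_neq0).
  exact: (br_uv_eq0 charK0 classL (d0 _ _)).
split; first exact: (dim_center charK0 classL B_neq0 d0 cp0).
split; first by exists p0.
split=> [p cp|].
  by rewrite (center_vline charK0 classL B_neq0 d0 cp) lspan_set1.
split.
  split; last exact: (nilpotent_of_center charK0 classL B_neq0).
  move=> /(nilP _ cp0)[cu cv].
  exact: (center_eq_commutator charK0 classL B_neq0 d0 cp0).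
by move=> p cp; rewrite (nilP p cp); exact: central_uvP.
Qed.
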